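(* Let $X$ and $Y$ be cellular spaces with $X$ compact and let $r\ge0$. Let maps $a,b,\tilde a,\tilde b\colon X\to Y$ satisfy $\tilde a\simeq a$, $a\overset{r}{\approx}b$, and $b\simeq\tilde b$ (where $\simeq$ is based homotopy). Then $\tilde a\overset{r}{\approx}\tilde b$.
   Context: Cellular space = based CW complex; maps are based. For a set $W$, $\langle W\rangle$ is the free abelian group on $W$ (basis $\langle w\rangle$). For $X$ compact Hausdorff, $Y^X$ is the space of based maps (compact-open topology), based at the constant map; $Y^X_a$ is the path component of $a$. Restriction homomorphisms are denoted $V\mapsto V|_R$. $\mathcal F_n(X)$ is the set of finite $R\subseteq X$ containing the basepoint with $|R|\le n+1$; $\langle Y^X\rangle^{(s)}=\{V\in\langle Y^X\rangle: V|_R=0$ in $\langle Y^R\rangle$ for all $R\in\mathcal F_{s-1}(X)\}$. For unbased spaces $U,V$, $V^{(U)}$ is the space of unbased maps $U\to V$, $\Xi^U(v)$ the constant map at $v$; for $U=\coprod_iU_i$, the combining product $\boxed{\sqcup}$ is the $\mathbb Z$-multilinear map with $\boxed{\sqcup}_i\langle w_i\rangle=\langle w\rangle$, $w|_{U_i}=w_i$. For a nonempty finite set $E$, $\Delta E$ is its simplex with faces $\Delta F$ ($\emptyset\ne F\subseteq E$); a layout is a set $A$ of pairwise disjoint nonempty subsets of $E$, $\Delta[A]=\coprod_{F\in A}\Delta F$; $S\in\langle V^{(\Delta E)}\rangle$ is fissile if $S|_{\Delta[A]}=\boxed{\sqcup}_{F\in A}S|_{\Delta F}$ for all layouts $A$.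 With $x_0$ the basepoint of $X$, $U\wr X=(U\times X)/(U\times\{x_0\})$, $\#^X\colon(Y^X)^{(U)}\to Y^{U\wr X}$, $\#^X(w)(u\wr x)=w(u)(x)$, and $\langle (Y^X)^{(U)}\rangle^{(s)}_X=\langle\#^X\rangle^{-1}(\langle Y^{U\wr X}\rangle^{(s)})$. Strong $r$-similarity $a\overset{r}{\approx}b$: for each nonempty finite $E$ there exists a fissile $S\in\langle (Y^X_a)^{(\Delta E)}\rangle$ with $\langle\Xi^{\Delta E}(b)\rangle-S\in\langle (Y^X)^{(\Delta E)}\rangle^{(r+1)}_X$. *)

(* Defs.v *)
From HB Require Import structures.
From mathcomp Require Import all_boot all_order all_algebra.
From mathcomp Require Import all_classical all_reals all_analysis.
From Stdlib Require List.

Set Implicit Arguments.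
Unset Strict Implicit.
Unset Printing Implicit Defensive.

Import Order.TTheory GRing.Theory Num.Theory.
Import numFieldNormedType.Exports.
Local Open Scope classical_set_scope.
Local Open Scope ring_scope.

Section Defs.
Variable R : realType.

(** ** CW complexes (Hatcher, Prop. A.2) and based CW complexes *)
Definition sqnorm n (v : 'rV[R]_n) : R := \sum_(j < n) v ord0 j ^+ 2.
Definition cdisk n : set 'rV[R]_n := [set v | sqnorm v <= 1].
Definition odisk n : set 'rV[R]_n := [set v | sqnorm v < 1].
Definition sphere n : set 'rV[R]_n := [set v | sqnorm v = 1].

(** A cellular space: a based CW complex, i.e. a Hausdorff space with a family
   of characteristic maps [Phi i : D^(dim i) -> X] such that (i) each [Phi i]
   restricts to a homeomorphism from the open disk onto its image, the cell
   [e_i], and the cells partition X; (ii) [Phi i] maps the boundary sphere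
   into finitely many cells of lower dimension; (iii) a set is closed iff it
   meets the closure of each cell in a closed set; and the basepoint is a
   0-cell. *)
Definition cellular_space (X : topologicalType) (x0 : X) : Prop :=
  hausdorff_space X /\
  exists (I : Type) (dim : I -> nat) (Phi : forall i, 'rV[R]_(dim i) -> X),
    let cell i := Phi i @` odisk (n:=dim i) in
    (forall i, {within cdisk (n:=dim i), continuous (Phi i)}) /\
    (forall i u v, odisk (n:=dim i) u -> odisk (n:=dim i) v ->
        Phi i u = Phi i v -> u = v) /\
    (forall i (O : set 'rV[R]_(dim i)), open O -> O `<=` odisk (n:=dim i) ->
        exists O' : set X, open O' /\ Phi i @` O = O' `&` cell i) /\
    (forall i j, i <> j -> cell i `&` cell j = set0) /\
    (forall x, exists i, cell i x) /\
    (forall i, exists s : seq I, (forall j, List.In j s -> (dim j < dim i)%N)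
        /\ Phi i @` sphere (n:=dim i) `<=` [set x | exists j, List.In j s /\ cell j x]) /\
    (forall A : set X, closed A <-> forall i, closed (A `&` closure (cell i))) /\
    (exists i, dim i = 0%N /\ cell i x0).

Variables (X Y : topologicalType) (x0 : X) (y0 : Y).

Definition based_map (f : X -> Y) : Prop := continuous f /\ f x0 = y0.

Definition unit_interval : set R := [set t | 0 <= t <= 1].

Definition based_homotopic (f g : X -> Y) : Prop :=
  exists H : X -> R -> Y,
    {within [set: X] `*` unit_interval, continuous (fun p : X * R => H p.1 p.2)} /\
    (forall x, H x 0 = f x) /\ (forall x, H x 1 = g x) /\
    (forall t, unit_interval t -> H x0 t = y0).

Definition path_comp (a f : X -> Y) : Prop :=
  exists g : R -> (X -> Y),
    g 0 = a /\ g 1 = f /\ (forall t, unit_interval t -> based_map (g t)) /\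
    {within unit_interval, continuous (g : R -> {compact-open, X -> Y})}.

Variable E : finType.

Definition simplex (F : {set E}) : set (E -> R) :=
  [set t | (forall e, 0 <= t e) /\ \sum_(e : E) t e = 1 /\
           (forall e, e \notin F -> t e = 0)].

Definition layout (A : {set {set E}}) : Prop :=
  (forall F, F \in A -> F != finset.set0) /\
  (forall F G, F \in A -> G \in A -> F != G -> F :&: G = finset.set0).

(** Delta[A], realised as the union of the (pairwise disjoint) faces *)
Definition layout_space (A : {set {set E}}) : set (E -> R) :=
  [set t | exists F, F \in A /\ simplex F t].

Definition simp_map (P : set (X -> Y)) (w : (E -> R) -> (X -> Y)) : Prop :=
  (forall t, simplex finset.setT t -> based_map (w t) /\ P (w t)) /\
  {within (simplex finset.setT : set {ptws E -> R}), continuous (w : {ptws E -> R} -> {compact-open, X -> Y})}.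

(** ** Free abelian groups: an element of <W> is represented by a formal sum,
   i.e. a list of (coefficient, generator); two generators are identified
   according to an equivalence relation [agree] (e.g. equality of
   restrictions to a subspace), which models the restriction homomorphisms. *)
Definition fcoef (W : Type) (agree : W -> W -> Prop) (s : seq (int * W)) (w : W) : int :=
  \sum_(p <- s) (if `[< agree p.2 w >] then p.1 else 0).

Definition feq (W : Type) (agree : W -> W -> Prop) (s s' : seq (int * W)) : Prop :=
  forall w, fcoef agree s w = fcoef agree s' w.

Definition fzero (W : Type) (agree : W -> W -> Prop) (s : seq (int * W)) : Prop :=
  forall w, fcoef agree s w = 0.

Definition agree_on (D : set (E -> R)) (w w' : (E -> R) -> (X -> Y)) : Prop :=
  forall t, D t -> w t = w' t.

Fixpoint combine (Fs : seq {set E}) (S : seq (int * ((E -> R) -> (X -> Y))))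
  : seq (int * ((E -> R) -> (X -> Y))) :=
  match Fs with
  | [::] => [:: (1%:Z, fun _ _ => y0)]
  | F :: Fs' =>
      [seq (p.1 * q.1, fun t => if `[< simplex F t >] then p.2 t else q.2 t)
        | p <- S, q <- combine Fs' S]
  end.

Definition fissile (S : seq (int * ((E -> R) -> (X -> Y)))) : Prop :=
  forall A : {set {set E}}, layout A ->
    feq (agree_on (layout_space A)) S (combine (enum A) S).

(** membership in <(Y^X)^(Delta E)>^(s)_X: the image under #^X restricts to
   zero on every R in F_(s-1)(Delta E wr X).  Such an R is the basepoint
   together with at most s-1 points (t, x), t in Delta E, listed in [ps]. *)
Definition in_filt (s : nat) (S : seq (int * ((E -> R) -> (X -> Y)))) : Prop :=
  forall ps : seq ((E -> R) * X), (size ps < s)%N ->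
    (forall p, List.In p ps -> simplex finset.setT p.1) ->
    fzero (fun w w' : (E -> R) -> (X -> Y) =>
             forall p, List.In p ps -> w p.1 p.2 = w' p.1 p.2) S.

End Defs.

Definition strongly_similar (R : realType) (X Y : topologicalType) (x0 : X) (y0 : Y)
  (r : nat) (a b : X -> Y) : Prop :=
  forall E : finType, (0 < #|E|)%N ->
    exists S : seq (int * ((E -> R) -> (X -> Y))),
      (forall p, List.In p S -> @simp_map R X Y x0 y0 E (path_comp R x0 y0 a) p.2) /\
      @fissile R X Y y0 E S /\
      @in_filt R X Y E r.+1 ((1%:Z, fun _ => b) :: [seq (- p.1, p.2) | p <- S]).

(* Main.v *)
(** Homotopic maps [a] and [a'] have the same path component in the mapping space, so
    the point is to replace [b] by a homotopic map [b'].  All simplices occurring in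
    the fissile ensemble [S], and the homotopy from [b] to [b'], take values in a
    finite subcomplex [K] of [Y].  Such a [K] is a neighbourhood retract of a normed
    space: there are an embedding [i] of [K] and a retraction [r] of a neighbourhood
    of [i K] onto [K]; this is proved by attaching one cell at a time.  If [b'] is
    uniformly close to [b], the ensemble is transported by the deformation
    [y |-> r (i y + s (i (b' x) - i (b x)))], [0 <= s <= 1], of [K] parametrised by
    [x], which is the identity for [s = 0] and sends [b x] to [b' x] for [s = 1].
    Acting on values only, it preserves fissility and the filtration.  An arbitrary
    homotopy is cut into small steps. *)

Require Import Defs.
From HB Require Import structures.
From mathcomp Require Import all_boot all_order all_algebra.
From mathcomp Require Import all_classical all_reals all_analysis.
From mathcomp Require Import lra ring.
Import numFieldNormedType.Exports.

Set Implicit Arguments.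
Unset Strict Implicit.
Unset Printing Implicit Defensive.

Import Order.TTheory GRing.Theory Num.Theory.
Local Open Scope classical_set_scope.
Local Open Scope ring_scope.

(** * Limits within subsets, comparisons near a point, and Euclidean disks *)

Lemma cvg_comp_within (T1 T2 T3 : topologicalType) (F : set_system T1)
    (f : T1 -> T2) (y : T2) (B : set T2) (g : T2 -> T3) : Filter F ->
  f @ F --> y -> (\forall x \near F, B (f x)) ->
  g @ within B (nbhs y) --> g y -> (g \o f) @ F --> g y.
Proof.
move=> FF fy fB gy O /gy /= /fy /= gO.
by apply: filterS2 fB gO => x Bx; apply.
Qed.

Section Gauge.
Variables (R : realType) (n : nat).
Implicit Types (v : 'rV[R]_n) (c : R).

(** This is the Euclidean norm; ['rV[R]_n] itself carries the maximum norm, so the disks of a cell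
    structure are not its balls. *)
Definition gauge v : R := Num.sqrt (sqnorm v).

Lemma sqnorm_ge0 v : 0 <= sqnorm v.
Proof. by apply: sumr_ge0 => i _; exact: sqr_ge0. Qed.

Lemma gaugeZ c v : gauge (c *: v) = `|c| * gauge v.
Proof.
rewrite /gauge /sqnorm (eq_bigr (fun j => c ^+ 2 * v ord0 j ^+ 2)); last first.
  by move=> j _; rewrite mxE exprMn.
by rewrite -mulr_sumr sqrtrM ?sqr_ge0// sqrtr_sqr.
Qed.

Lemma cdiskE v : cdisk v <-> gauge v <= 1.
Proof. by rewrite /cdisk/= /gauge -{2}(@sqrtr1 R) ler_sqrt. Qed.

Lemma odiskE v : odisk v <-> gauge v < 1.
Proof. by rewrite /odisk/= /gauge -{2}(@sqrtr1 R) ltr_sqrt. Qed.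

Lemma sphereE v : sphere v <-> gauge v = 1.
Proof.
rewrite /sphere/= /gauge; split=> [->|]; first exact: sqrtr1.
by move=> /(congr1 (fun x => x ^+ 2)); rewrite sqr_sqrtr ?sqnorm_ge0// expr1n.
Qed.

Lemma gauge_continuous : continuous gauge.
Proof.
move=> v; apply: (@continuous_comp _ _ _ (@sqnorm R n) Num.sqrt); last first.
  exact: sqrt_continuous.
move: v; rewrite /sqnorm; apply: continuous_big => [|j _ v].
  exact: add_continuous.
apply: (@continuous_comp _ _ _ (fun w : 'rV[R]_n => w ord0 j) (fun x => x ^+ 2)).
  exact: coord_continuous.
exact: exprn_continuous.
Qed.

Lemma cdisk_compact : compact (@cdisk R n).
Proof.
apply: bounded_closed_compact.
  exists 1; split=> // M M1 v /= v1; rewrite (le_trans _ (ltW M1))//.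
  rewrite [leLHS]/Num.norm/= mx_normrE; apply/bigmax_leP; split=> // -[i j] _/=.
  rewrite (ord1 i) -(@ler_pXn2r _ 2)// ?nnegrE// expr1n real_normK ?num_real//.
  apply: le_trans v1; rewrite /sqnorm (bigD1 j)//= lerDl.
  by apply: sumr_ge0 => k _; exact: sqr_ge0.
rewrite (_ : cdisk (n:=n) = gauge @^-1` [set x | x <= 1]); last first.
  by apply/seteqP; split=> v /cdiskE.
by apply: closed_comp => [v _|]; [exact: gauge_continuous|exact: closed_le].
Qed.

End Gauge.

Section NearComparison.
Variables (R : realType) (T : topologicalType) (f g : T -> R) (x : T).
Hypotheses (fx : f @ x --> f x) (gx : g @ x --> g x).

Lemma near_lt_fun : f x < g x -> \forall y \near x, f y < g y.
Proof.
move=> fg; have h : (f \- g) @ x --> f x - g x by exact: cvgB.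
have : f x - g x < 0 by rewrite subr_lt0.
by move=> /(cvgr_lt _ h); apply: filterS => y /=; rewrite subr_lt0.
Qed.

Lemma cvg_max_fun : Num.max (f y) (g y) @[y --> x] --> Num.max (f x) (g x).
Proof. exact: (@continuous_max _ _ f g x fx gx). Qed.

End NearComparison.

Lemma near_lt_cst (R : realType) (T : topologicalType) (f : T -> R) x c :
  f @ x --> f x -> f x < c -> \forall y \near x, f y < c.
Proof. by move=> fx; apply: (@near_lt_fun R T f (cst c)) => //; exact: cvg_cst. Qed.

Lemma near_gt_cst (R : realType) (T : topologicalType) (f : T -> R) x c :
  f @ x --> f x -> c < f x -> \forall y \near x, c < f y.
Proof. by move=> fx; apply: (@near_lt_fun R T (cst c) f) => //; exact: cvg_cst. Qed.

Lemma cvg_pair_pt (T : Type) (U V : topologicalType) (F : set_system T)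
    (f : T -> U) (g : T -> V) (a : U) (b : V) : Filter F ->
  f @ F --> a -> g @ F --> b -> (f x, g x) @[x --> F] --> (a, b).
Proof. by move=> FF fa gb; exact: cvg_pair fa gb. Qed.

Lemma within_subset_near (T : Type) (F : set_system T) (A P : set T) : Filter F ->
  A `<=` P -> \forall x \near within A F, P x.
Proof. by move=> FF AP; apply: filterS AP _; exact: withinT. Qed.

Lemma cvg_within_restrict (T : Type) (U : topologicalType) (F : set_system T)
    (A : set T) (f : T -> U) (l : U) : Filter F -> f @ F --> l ->
  f @ within A F --> l.
Proof. by move=> FF fl; apply: cvg_trans fl; apply: cvg_app; exact: cvg_within. Qed.

(** * Attaching a cell to a neighbourhood retract *)

(** [i] and [r] are total functions constrained only on [K] and on [U], so [K] stays a plain subset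
    of [Y]. Injectivity of [i] on [K] is contained in [r (i y) = y]. *)
Definition nbhd_retract (R : realType) (Y : topologicalType) (K : set Y) : Prop :=
  exists (V : normedModType R) (i : Y -> V) (U : set V) (r : V -> Y),
    [/\ {within K, continuous i}, open U, {in U, continuous r},
        (forall u, U u -> K (r u)) & (forall y, K y -> U (i y) /\ r (i y) = y)].

Section Attach.
Variables (R : realType) (D : normedModType R) (q : D -> R).
Hypothesis qZ : forall c v, q (c *: v) = `|c| * q v.
Hypothesis q_cont : continuous q.
Hypothesis q_compact : compact [set v | q v <= 1].
Variables (Y : topologicalType) (A : set Y) (Phi : D -> Y).
Hypothesis hausY : hausdorff_space Y.
Hypothesis closedA : closed A.
Hypothesis Phi_cont : {within [set v | q v <= 1], continuous Phi}.
Hypothesis Phi_inj :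
  forall u v, q u < 1 -> q v < 1 -> Phi u = Phi v -> u = v.
Hypothesis Phi_odisk : forall v, q v < 1 -> ~ A (Phi v).
Hypothesis Phi_sphere : forall v, q v = 1 -> A (Phi v).
Variables (V : normedModType R) (iA : Y -> V) (UA : set V) (rA : V -> Y).
Hypothesis iA_cont : {within A, continuous iA}.
Hypothesis UA_open : open UA.
Hypothesis rA_cont : {in UA, continuous rA}.
Hypothesis rA_in : forall u, UA u -> A (rA u).
Hypothesis rAK : forall y, A y -> UA (iA y) /\ rA (iA y) = y.

(** Radial projection to the sphere breaks down at the origin. The factor [ramp], zero up to [1 / 4]
    and one from [1 / 2] on, cuts it off there and makes [j] continuous on all of [D]. *)
Let ramp (t : R) : R := Num.min 1 (Num.max 0 (4 * t - 1)).
Let j (v : D) : V := ramp (q v) *: iA (Phi ((q v)^-1 *: v)).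

Let ramp_continuous : continuous ramp.
Proof.
move=> t; rewrite /ramp.
apply: (@continuous_min _ _ (cst 1) (fun t : R => Num.max 0 (4 * t - 1))).
  exact: cvg_cst.
apply: (@continuous_max _ _ (cst 0) (fun t : R => 4 * t - 1)).
  exact: cvg_cst.
by apply: cvgB; [apply: cvgM; [exact: cvg_cst|exact: cvg_id]|exact: cvg_cst].
Qed.

Let ramp1 t : 1 / 2 <= t -> ramp t = 1.
Proof. by move=> ht; rewrite /ramp; apply/min_idPl; rewrite le_max; lra. Qed.

Let ramp0 t : t <= 1 / 4 -> ramp t = 0.
Proof.
move=> ht; rewrite /ramp (_ : Num.max 0 (4 * t - 1) = 0); last by apply/max_idPl; lra.
by apply/min_idPr; rewrite ler01.
Qed.

Let normalize_sphere v : 0 < q v -> q ((q v)^-1 *: v) = 1.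
Proof.
move=> v0; rewrite qZ ger0_norm ?invr_ge0 ?ltW//.
by rewrite mulVf// gt_eqF.
Qed.

Let j_sphere v : q v = 1 -> j v = iA (Phi v).
Proof.
by move=> v1; rewrite /j v1 invr1 !scale1r ramp1 ?scale1r//; lra.
Qed.

(** The cut-off equals one at both points, and normalisation cancels the positive factor [c]. *)
Let jZ c v : 0 < c -> 1 / 2 <= q v -> 1 / 2 <= q (c *: v) -> j (c *: v) = j v.
Proof.
move=> c0 v1 cv1; rewrite /j !ramp1// !scale1r; congr (iA (Phi _)).
rewrite qZ gtr0_norm// scalerA invfM mulrAC mulVf ?gt_eqF//.
by rewrite mul1r.
Qed.

Let j_cont : continuous j.
Proof.
move=> v; have [v4|v4] := ltP (q v) (1 / 4).
  have j0 : \forall w \near v, j w = 0.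
    have : \forall w \near v, q w < 1 / 4.
      exact: (near_lt_cst (@q_cont v) v4).
    by apply: filterS => w w4; rewrite /j ramp0 ?scale0r// ltW.
  rewrite /continuous_at (nbhs_singleton j0).
  exact: cvg_near_cst.
have v0 : 0 < q v by apply: lt_le_trans v4; lra.
have nv0 : \forall w \near v, 0 < q w.
  exact: (near_gt_cst (@q_cont v) v0).
apply: cvgZ.
  by apply: continuous_comp; [exact: q_cont|exact: ramp_continuous].
have cn : (q w)^-1 *: w @[w --> v] --> (q v)^-1 *: v.
  apply: cvgZ; last exact: cvg_id.
  by apply: cvgV; [rewrite gt_eqF|exact: q_cont].
apply: (@cvg_comp_within _ _ _ _ (fun w => Phi ((q w)^-1 *: w)) _ A iA).
- apply: (@cvg_comp_within _ _ _ _ (fun w => (q w)^-1 *: w) _ [set v | q v <= 1] Phi).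
  + exact: cn.
  + by apply: filterS nv0 => w w0; rewrite /= normalize_sphere.
  + apply: (proj1 (subspace_continuousP _ _) Phi_cont).
    by rewrite /= normalize_sphere.
- by apply: filterS nv0 => w w0; exact/Phi_sphere/normalize_sphere.
- apply: (proj1 (subspace_continuousP _ _) iA_cont).
  exact/Phi_sphere/normalize_sphere.
Qed.

(* [A] together with the disk is embedded in [V * D * R] by sending [Phi w] to
   [(j w, (1 - q w) *: w, 1 - q w)] and [y] in [A] to [(iA y, 0, 0)]; [j] extends
   [iA \o Phi] from the sphere.  For [z = (p, g, u)] with [u > 0], [vec z] recovers
   [w], and [dev z] vanishes exactly on the image.  The retraction [ret] uses [Phi]
   where [dev z < u / 2], and [rA] elsewhere; as [dev z] grows from [0] to [u / 2],
   [psi z] moves radially from [w] to the sphere, and as it grows from [u / 2] to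
   [u], [kap z] moves along a segment from [j w] to [p]. *)
Local Notation W := (V * D * R)%type.
Implicit Types z : W.

Let vec z : D := z.2^-1 *: z.1.2.
Let dev z : R := `|z.1.1 - j (vec z)| + `|q (vec z) - 1 + z.2|.
Let psi z : D := (Num.max (q (vec z)) (1 - 3 * dev z))^-1 *: vec z.
Let kap z : V :=
  if 0 < z.2 then z.1.1 + Num.max 0 (2 - 2 * dev z / z.2) *: (j (vec z) - z.1.1)
  else z.1.1.
Let ret z : Y := if (0 < z.2) && (dev z < z.2 / 2) then Phi (psi z) else rA (kap z).

(** [dom1] contains the image of the open cell, [dom2] that of [A]. The bound [1 / 3] keeps
    [1 - 3 * dev z], hence the divisor in [psi], positive. In [dom2] the ball is doubled because
    [kap] may move the first component by nearly [e]; [z.2 < 1 / 4] forces [dev z < 1 / 3] in the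
    [Phi] regime and keeps [vec z] outside radius [1 / 2] there. *)
Let dom1 : set W := [set z | [/\ 0 < z.2, dev z < z.2 / 2 & dev z < 1 / 3]].
Let dom2 : set W := [set z | exists a e, [/\ A a, 0 < e, ball (iA a) (e + e) `<=` UA,
  ball (iA a) e z.1.1 & z.2 < Num.min e (1 / 4)]].
Let dom := dom1 `|` dom2.

Let dev_ge0 z : 0 <= dev z.
Proof. by rewrite addr_ge0. Qed.

Let fst1_cont z : z'.1.1 @[z' --> z] --> z.1.1.
Proof. by apply: cvg_comp; [exact: cvg_fst|exact: cvg_fst]. Qed.

Let snd_cont z : z'.2 @[z' --> z] --> z.2.
Proof. exact: cvg_snd. Qed.

Let vec_cont z : z.2 != 0 -> vec z' @[z' --> z] --> vec z.
Proof.
move=> z0; apply: cvgZ; first by apply: cvgV => //; exact: cvg_snd.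
by apply: cvg_comp; [exact: cvg_fst|exact: cvg_snd].
Qed.

Let dev_cont z : z.2 != 0 -> dev z' @[z' --> z] --> dev z.
Proof.
move=> z0; apply: cvgD; apply: cvg_norm.
  apply: cvgB; first exact: fst1_cont.
  by apply: (cvg_comp _ _ (vec_cont z0)); exact: j_cont.
apply: cvgD; last exact: snd_cont.
apply: cvgB; last exact: cvg_cst.
by apply: (cvg_comp _ _ (vec_cont z0)); exact: q_cont.
Qed.

Let psi_cdisk z : dev z < 1 / 3 -> q (psi z) <= 1.
Proof.
move=> z3; rewrite qZ.
have m0 : 0 < Num.max (q (vec z)) (1 - 3 * dev z) by rewrite lt_max; apply/orP; right; lra.
rewrite gtr0_norm ?invr_gt0// mulrC ler_pdivrMr// mul1r.
by rewrite le_max lexx.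
Qed.

Let psi_cont z : z.2 != 0 -> dev z < 1 / 3 -> psi z' @[z' --> z] --> psi z.
Proof.
move=> z0 z3; apply: cvgZ; last exact: vec_cont.
have m0 : 0 < Num.max (q (vec z)) (1 - 3 * dev z) by rewrite lt_max; apply/orP; right; lra.
apply: cvgV; first by rewrite gt_eqF.
apply: (@cvg_max_fun R W (fun z => q (vec z)) (fun z => 1 - 3 * dev z)).
  by apply: (cvg_comp _ _ (vec_cont z0)); exact: q_cont.
apply: cvgB; first exact: cvg_cst.
by apply: cvgM; [exact: cvg_cst|exact: dev_cont].
Qed.

Let Phi_psi_cont z : z.2 != 0 -> dev z < 1 / 3 ->
  Phi (psi z') @[z' --> z] --> Phi (psi z).
Proof.
move=> z0 z3; apply: (@cvg_comp_within _ _ _ _ psi _ [set v | q v <= 1] Phi).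
- exact: psi_cont.
- have : \forall z' \near z, dev z' < 1 / 3.
    exact: (near_lt_cst (dev_cont z0) z3).
  by apply: filterS => z'; exact: psi_cdisk.
- by apply: (proj1 (subspace_continuousP _ _) Phi_cont); exact: psi_cdisk.
Qed.

(** For [u = z.2 > 0] and [d = dev z] the displacement is at most the larger of [0] and
    [(2 - 2 d / u) d], and [u - (2 - 2 d / u) d = ((u - d)^2 + d^2) / u]. This keeps [kap z] in [UA]
    on [dom2] and makes [kap] continuous across [u = 0]. *)
Let kap_near z : `|kap z - z.1.1| <= Num.max 0 z.2.
Proof.
rewrite /kap; case: ifPn => [z0|_]; last by rewrite subrr normr0 le_max lexx.
rewrite addrC addKr normrZ le_max; apply/orP; right.
have d1 : `|j (vec z) - z.1.1| <= dev z by rewrite distrC /dev lerDl.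
rewrite ger0_norm ?le_max ?lexx//.
apply: le_trans (ler_wpM2l _ d1) _; first by rewrite le_max lexx.
have [h|h] := leP 0 (2 - 2 * dev z / z.2); last by rewrite mul0r ltW.
rewrite mulrBl lerBlDr -subr_ge0.
have -> : z.2 + 2 * dev z / z.2 * dev z - 2 * dev z =
  z.2^-1 * ((z.2 - dev z) ^+ 2 + dev z ^+ 2) by field; rewrite gt_eqF.
apply: mulr_ge0; first by rewrite invr_ge0 ltW.
by rewrite addr_ge0 ?sqr_ge0.
Qed.

Let kap_cont z : kap z' @[z' --> z] --> kap z.
Proof.
have [z0|z0] := ltP 0 z.2.
  have zn0 : z.2 != 0 by rewrite gt_eqF.
  have kE : kap z = z.1.1 + Num.max 0 (2 - 2 * dev z / z.2) *: (j (vec z) - z.1.1).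
    by rewrite /kap z0.
  have H : (z'.1.1 + Num.max 0 (2 - 2 * dev z' / z'.2) *: (j (vec z') - z'.1.1))
      @[z' --> z] --> z.1.1 + Num.max 0 (2 - 2 * dev z / z.2) *: (j (vec z) - z.1.1).
    apply: cvgD; first exact: fst1_cont.
    apply: (@cvgZ _ _ _ _ _ (fun z => Num.max 0 (2 - 2 * dev z / z.2))
      (fun z => j (vec z) - z.1.1)).
      apply: (@cvg_max_fun R W (cst 0) (fun z => 2 - 2 * dev z / z.2)); first exact: cvg_cst.
      apply: cvgB; first exact: cvg_cst.
      apply: cvgM; last by apply: cvgV => //; exact: snd_cont.
      by apply: cvgM; [exact: cvg_cst|exact: dev_cont].
    apply: cvgB; last exact: fst1_cont.
    by apply: (cvg_comp _ _ (vec_cont zn0)); exact: j_cont.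
  rewrite kE; apply: cvg_trans H; apply: near_eq_cvg.
  have : \forall z' \near z, 0 < z'.2 by exact: (near_gt_cst (snd_cont (z:=z)) z0).
  by apply: filterS => z' z'0; rewrite /kap z'0.
have -> : kap z = z.1.1 by rewrite /kap ltNge z0.
apply/cvgrPdist_lt => e e0; have e2 : 0 < e / 2 by rewrite divr_gt0.
have n1 : \forall z' \near z, `|z.1.1 - z'.1.1| < e / 2.
  by move: (fst1_cont (z:=z)) => /cvgrPdist_lt /(_ _ e2).
have n2 : \forall z' \near z, z'.2 < e / 2.
  exact: (near_lt_cst (snd_cont (z:=z)) (le_lt_trans z0 e2)).
apply: filterS2 n1 n2 => z' h1 h2.
have -> : z.1.1 - kap z' = (z.1.1 - z'.1.1) - (kap z' - z'.1.1).
  by rewrite opprB addrA subrK.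
rewrite (le_lt_trans (ler_normB _ _))// (splitr e) ltr_leD//.
by rewrite (le_trans (kap_near _))// ge_max (ltW e2) ltW.
Qed.

(** This serves the continuity of [ret] at [z.2 = 0], where [vec] degenerates. By compactness of the
    disk it suffices to look near one [w]. If [q w = 1] and [p = j w], then [Phi w = rA p] and
    continuity of [Phi] applies; otherwise [|p - j w| + (1 - q w)] is bounded below near [w], so the
    premises fail for small [e]. *)
Let Phi_near_sphere p O : UA p -> nbhs (rA p) O -> exists2 e : R, 0 < e &
  forall w, q w <= 1 -> `|p - j w| < e -> 1 - e < q w -> O (Phi w).
Proof.
move=> Up nO.
pose P (e : R) w := `|p - j w| < e -> 1 - e < q w -> O (Phi w).
suff : \forall e \near 0^'+, [set v | q v <= 1] `<=` P e.
  move=> /(filterI (nbhs_right_gt 0)) /filter_ex[e [e0 eP]].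
  by exists e => // w /eP.
have /near_covering_withinP := proj1 (compact_near_coveringP _) q_compact.
apply=> w /= w1; have [[w1' jw]|] := pselect (q w = 1 /\ p = j w).
  exists ([set w' | q w' <= 1 -> O (Phi w')], setT); last first.
    by move=> [w' e] [/= h _] w'1 _ _; exact: h.
  split; last exact: filterT.
  have PwE : rA p = Phi w by rewrite jw j_sphere//; have [] := rAK (Phi_sphere w1').
  rewrite PwE in nO; exact: (proj1 (subspace_continuousP _ _) Phi_cont w w1 _ nO).
move=> nwj; pose e := `|p - j w| + (1 - q w).
have e0 : 0 < e.
  rewrite lt_neqAle addr_ge0 ?subr_ge0// andbT eq_sym; apply/eqP => ew.
  apply: nwj; move: ew => /eqP; rewrite paddr_eq0 ?subr_ge0// normr_eq0 !subr_eq0.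
  by move=> /andP[/eqP -> /eqP <-].
exists ([set w' | e / 2 < `|p - j w'| + (1 - q w')], [set e' | e' < e / 4]).
  split => /=; last by apply: nbhs_right_lt; rewrite divr_gt0.
  apply: (@near_gt_cst R D (fun w' => `|p - j w'| + (1 - q w'))); last first.
    by rewrite -/e; lra.
  apply: cvgD.
    by apply: cvg_norm; apply: cvgB; [exact: cvg_cst|exact: j_cont].
  by apply: cvgB; [exact: cvg_cst|exact: q_cont].
by move=> [w' e'] [/= h1 h2] h3 h4 h5; exfalso; lra.
Qed.

Let dom2_kap z : dom2 z -> UA (kap z).
Proof.
move=> [a [e [Aa e0 aU ap]]]; rewrite lt_min => /andP[ze _].
apply: aU; apply: ball_triangle ap _; rewrite -ball_normE/= distrC.
by rewrite (le_lt_trans (kap_near _))// gt_max e0.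
Qed.

Let dom_dev z : dom z -> 0 < z.2 -> dev z < z.2 / 2 -> dev z < 1 / 3.
Proof.
move=> [[]//|[a [e [_ _ _ _]]]]; rewrite lt_min => /andP[_ z4] _ h.
by apply: lt_trans h _; lra.
Qed.

Let dom_open : open dom.
Proof.
rewrite openE => z [[z0 z1 z2]|[a [e [Aa e0 aU ap ze]]]].
  have zn0 : z.2 != 0 by rewrite gt_eqF.
  have n0 := near_gt_cst (snd_cont (z:=z)) z0.
  have n1 : \forall z' \near z, dev z' < z'.2 / 2.
    apply: (@near_lt_fun R W dev (fun z => z.2 / 2)) => //; first exact: dev_cont.
    by apply: cvgM; [exact: snd_cont|exact: cvg_cst].
  have n2 := near_lt_cst (dev_cont zn0) z2.
  rewrite /interior; near=> z'; left; split.
  - by near: z'.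
  - by near: z'.
  - by near: z'.
have n1 : \forall z' \near z, ball (iA a) e z'.1.1.
  by apply: (fst1_cont (z:=z)); apply: open_nbhs_nbhs; split => //; exact: ball_open.
have n2 := near_lt_cst (snd_cont (z:=z)) ze.
rewrite /interior; near=> z'; right; exists a, e; split => //.
- by near: z'.
- by near: z'.
Unshelve. all: by end_near. Qed.

Let ret_in z : dom z -> (A `|` Phi @` [set v | q v <= 1]) (ret z).
Proof.
move=> dz; rewrite /ret; case: ifPn => [/andP[z0 z1]|].
  by right; exists (psi z) => //; apply/psi_cdisk/dom_dev.
rewrite negb_and -leNgt => nz; left; apply: rA_in; apply: dom2_kap.
by case: dz nz => // -[z0 z1 _]; rewrite z1 orbF leNgt z0.
Qed.

(* At the common boundary [dev z = z.2 / 2] of the two regimes both formulas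
   send [z] to the image under [Phi] of the normalised vector. *)
Let ret_glue z : dom2 z -> 0 < z.2 -> dev z = z.2 / 2 -> rA (kap z) = Phi (psi z).
Proof.
move=> [a [e [_ _ _ _]]]; rewrite lt_min => /andP[_ z4] z0 dz.
have qd : `|q (vec z) - 1 + z.2| <= z.2 / 2 by rewrite -dz /dev lerDr.
(* As [dev z = z.2 / 2], this reads [q (vec z) >= 1 - 3 * dev z]: the slope [3] in [psi] makes
   [q (vec z)] the maximum on the common boundary. *)
have {qd} qv : 1 - 3 * (z.2 / 2) <= q (vec z) by move: qd; rewrite ler_norml => /andP[]; lra.
have qp : 0 < q (vec z) by lra.
have -> : kap z = j (vec z).
  rewrite /kap z0 dz (_ : 2 - 2 * (z.2 / 2) / z.2 = 1); last by field; rewrite gt_eqF.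
  by rewrite (max_idPr ler01) scale1r addrC subrK.
rewrite /psi dz (max_idPl qv) -{1}[vec z](@scalerKV _ _ (q (vec z))) ?gt_eqF//.
rewrite jZ//; last 2 first.
- by rewrite normalize_sphere//; lra.
- by rewrite scalerA divff ?gt_eqF// scale1r; lra.
rewrite j_sphere ?normalize_sphere//.
by have [_ ->] := rAK (Phi_sphere (normalize_sphere qp)).
Qed.

(** Here [q (vec z) >= 1 - 3 * (z.2 / 2)], and the division in [psi] only helps: either the divisor
    is [1 - 3 * dev z <= 1], or it is [q (vec z)] and [psi z] has gauge one. Both vectors lie
    outside radius [1 / 2], so [jZ] applies. *)
Let psi_near_sphere z (e : R) : 0 < z.2 -> z.2 < 1 / 4 -> dev z < z.2 / 2 ->
  2 * z.2 < e -> 1 - e < q (psi z) /\ j (psi z) = j (vec z).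
Proof.
move=> z0 z4 dz ze.
have qd : `|q (vec z) - 1 + z.2| <= z.2 / 2.
  by apply: le_trans (ltW dz); rewrite /dev lerDr.
have {qd} qv : 1 - 3 * (z.2 / 2) <= q (vec z) by move: qd; rewrite ler_norml => /andP[]; lra.
set m := Num.max (q (vec z)) (1 - 3 * dev z).
have m0 : 0 < m by rewrite lt_max; apply/orP; right; lra.
have d0 := dev_ge0 z.
have qpsi : 1 - 3 * (z.2 / 2) <= q (psi z).
  rewrite /psi -/m qZ gtr0_norm ?invr_gt0// [leRHS]mulrC ler_pdivlMr//.
  rewrite /m; have [h|h] := leP (q (vec z)) (1 - 3 * dev z); last by nra.
  by nra.
split; first by lra.
apply: jZ; rewrite ?invr_gt0//; first by lra.
by rewrite -/(psi z); lra.
Qed.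

Let ret_cont z : dom z -> ret z' @[z' --> z] --> ret z.
Proof.
move=> dz; have [/andP[z0 z1]|] := boolP ((0 < z.2) && (dev z < z.2 / 2)).
  have zn0 : z.2 != 0 by rewrite gt_eqF.
  have z3 := dom_dev dz z0 z1.
  have -> : ret z = Phi (psi z) by rewrite /ret z0 z1.
  apply: cvg_trans (Phi_psi_cont zn0 z3).
  have n0 := near_gt_cst (snd_cont (z:=z)) z0.
  have n1 : \forall z' \near z, dev z' < z'.2 / 2.
    apply: (@near_lt_fun R W dev (fun z => z.2 / 2)) => //; first exact: dev_cont.
    by apply: cvgM; [exact: snd_cont|exact: cvg_cst].
  by apply: near_eq_cvg; apply: filterS2 n0 n1 => z' h0 h1; rewrite /ret h0 h1.
move=> nz; have rz : ret z = rA (kap z) by rewrite /ret (negbTE nz).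
move: nz; rewrite negb_and -leNgt => nz.
have dz2 : dom2 z by case: dz nz => // -[z0 z1 _]; rewrite z1 orbF leNgt z0.
have Uk := dom2_kap dz2.
have ck : rA (kap z') @[z' --> z] --> rA (kap z).
  by apply: (cvg_comp _ _ (kap_cont (z:=z))); apply: rA_cont; rewrite inE.
move=> O; rewrite rz => nO.
(* Nearby points in the [rA] regime are covered by [ck]; those in the [Phi] regime remain. There are
   none if [z.2 < 0] or [dev z > z.2 / 2 > 0], and on the common boundary [ret_glue] applies. *)
suff nP : \forall z' \near z, 0 < z'.2 -> dev z' < z'.2 / 2 -> O (Phi (psi z')).
  have := ck _ nO; apply: filterS2 nP => z' /= h1 h2.
  by rewrite /ret; case: ifPn => [/andP[]|].
have z4 : z.2 < 1 / 4 by case: dz2 => a [e [_ _ _ _]]; rewrite lt_min => /andP[].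
have [z0|z0|z0] := ltgtP z.2 0.
- have := near_lt_cst (snd_cont (z:=z)) z0.
  by apply: filterS => z' h1 h2; move: (lt_trans h1 h2); rewrite ltxx.
- have zn0 : z.2 != 0 by rewrite gt_eqF.
  have z1 : z.2 / 2 <= dev z by move: nz; rewrite leNgt z0/= -leNgt.
  have [z1'|z1'] := eqVneq (dev z) (z.2 / 2).
    have z3 : dev z < 1 / 3 by rewrite z1'; lra.
    have nO' : nbhs (Phi (psi z)) O by rewrite -ret_glue.
    have h : \forall z' \near z, O (Phi (psi z')) := Phi_psi_cont zn0 z3 nO'.
    by apply: filterS h => z' h _ _.
  have n1 : \forall z' \near z, z'.2 / 2 < dev z'.
    apply: (@near_lt_fun R W (fun z => z.2 / 2) dev); last by rewrite lt_neqAle eq_sym z1'.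
      by apply: cvgM; [exact: snd_cont|exact: cvg_cst].
    exact: dev_cont.
  by apply: filterS n1 => z' h1 _ h2; move: (lt_trans h1 h2); rewrite ltxx.
(* For [z.2 = 0] nearby points of the [Phi] regime have [psi z'] close to the sphere and
   [j (psi z')] close to [z.1.1], the situation of [Phi_near_sphere]: the first component moves by
   less than [e / 2], and [dev z' < e / 8]. *)
have kz : kap z = z.1.1 by rewrite /kap z0 ltxx.
rewrite kz in Uk nO.
have [e e0 eP] := Phi_near_sphere Uk nO.
have n1 : \forall z' \near z, `|z.1.1 - z'.1.1| < e / 2.
  by move: (fst1_cont (z:=z)) => /cvgrPdist_lt; apply; rewrite divr_gt0.
have n2 : \forall z' \near z, z'.2 < Num.min (e / 4) (1 / 4).
  apply: near_lt_cst; first exact: snd_cont.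
  by rewrite z0 lt_min; apply/andP; split; lra.
apply: filterS2 n1 n2 => z' h1; rewrite lt_min => /andP[h2 h3] h4 h5.
have ze : 2 * z'.2 < e by lra.
have [h6 h7] := psi_near_sphere h4 h3 h5 ze.
apply: eP => //; first by apply: psi_cdisk; lra.
rewrite h7 -(subrKA z'.1.1) (le_lt_trans (ler_normD _ _))//.
have : `|z'.1.1 - j (vec z')| <= dev z' by rewrite /dev lerDl.
by lra.
Qed.

Let emb y : W :=
  if pselect (A y) then (iA y, 0, 0)
  else let w := xget 0 [set w | q w <= 1 /\ Phi w = y] in (j w, (1 - q w) *: w, 1 - q w).

Let embA y : A y -> emb y = (iA y, 0, 0).
Proof. by rewrite /emb; case: pselect. Qed.

(** The two formulas meet on the sphere by [j_sphere]. In the open disk the preimage chosen by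
    [xget] cannot lie on the sphere, whose image is in [A], so [Phi_inj] identifies it with [w]. *)
Let embPhi w : q w <= 1 -> emb (Phi w) = (j w, (1 - q w) *: w, 1 - q w).
Proof.
rewrite le_eqVlt => /orP[/eqP w1|w1].
  by rewrite embA; [rewrite j_sphere// w1 subrr scale0r|exact: Phi_sphere].
rewrite /emb; case: pselect => [Aw|nAw]; first by case: (Phi_odisk w1).
cbv zeta; set w' := xget _ _.
have [+ ww'] : q w' <= 1 /\ Phi w' = Phi w.
  apply: (@xgetPex _ 0 [set w' | q w' <= 1 /\ Phi w' = Phi w]).
  by exists w; split => //; exact: ltW.
rewrite le_eqVlt => /orP[/eqP/Phi_sphere|w'1].
  by rewrite ww' => Aw; case: (Phi_odisk w1).
by rewrite (Phi_inj w'1 w1 ww').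
Qed.

Let emb_cont : {within A `|` Phi @` [set v | q v <= 1], continuous emb}.
Proof.
have cptP : compact (Phi @` [set v | q v <= 1]) by exact: continuous_compact.
apply: withinU_continuous => //; first exact: compact_closed.
  apply: (@subspace_eq_continuous _ _ _ (fun y => (iA y, 0, 0) : W)).
    by move=> y; rewrite inE => Ay; exact: esym (embA Ay).
  apply/subspace_continuousP => y Ay.
  apply: cvg_pair_pt; last exact: cvg_cst.
  apply: cvg_pair_pt; last exact: cvg_cst.
  exact: (proj1 (subspace_continuousP _ _) iA_cont).
(* On the image of the disk, the preimage of a closed [C] is the [Phi]-image of a compact set of
   disk points, hence closed in the Hausdorff space [Y]. *)
apply/continuous_closedP => C cC; apply/closed_subspaceP.
exists (Phi @` ([set v | q v <= 1] `&`
   (fun w => (j w, (1 - q w) *: w, 1 - q w) : W) @^-1` C)).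
  apply: compact_closed => //; apply: continuous_compact.
    by apply: continuous_subspaceW Phi_cont => v [].
  apply: compact_closedI => //; apply: closed_comp => // w _.
  have c1 : (1 - q w') @[w' --> w] --> 1 - q w.
    by apply: cvgB; [exact: cvg_cst|exact: q_cont].
  apply: cvg_pair_pt => //; apply: cvg_pair_pt; first exact: j_cont.
  by apply: cvgZ => //; exact: cvg_id.
apply/seteqP; split => y /=.
  by move=> [[w [w1 Cw] <-] h]; split => //; suff : C (emb (Phi w)) by []; rewrite embPhi.
move=> [Cy [w w1 wy]]; split; last by exists w.
have Cw : C (emb (Phi w)) by rewrite wy.
by rewrite embPhi// in Cw; exists w.
Qed.

Let embK y : (A `|` Phi @` [set v | q v <= 1]) y -> dom (emb y) /\ ret (emb y) = y.
Proof.
have [Ay _|nAy [//|[w /= + wy]]] := pselect (A y).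
  rewrite embA//; have [Uy ry] := rAK Ay; split; last by rewrite /ret /kap /= ltxx.
  right; have /nbhs_ballP[e /= e0 eU] : nbhs (iA y) UA by exact: open_nbhs_nbhs.
  exists y, (e / 2); split => //=.
  - by rewrite divr_gt0.
  - by rewrite -splitr.
  - by apply: ballxx; rewrite divr_gt0.
  - by rewrite lt_min; apply/andP; split; lra.
rewrite le_eqVlt => /orP[/eqP/Phi_sphere|w1]; first by rewrite wy.
have vw : vec (emb y) = w.
  rewrite -wy embPhi ?ltW// /vec/= scalerA mulVf ?scale1r// subr_eq0.
  by rewrite gt_eqF.
have z2 : (emb y).2 = 1 - q w by rewrite -wy embPhi ?ltW.
have d0 : dev (emb y) = 0.
  rewrite /dev vw z2 -wy embPhi ?ltW//= subrr normr0 add0r.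
  by apply/eqP; rewrite normr_eq0; apply/eqP; ring.
have z0 : 0 < (emb y).2 by rewrite z2 subr_gt0.
split; first by left; split => //; rewrite d0 ?divr_gt0//; lra.
rewrite /ret z0 d0 divr_gt0//= /psi vw d0 mulr0 subr0.
by rewrite (max_idPr (ltW w1)) invr1 scale1r.
Qed.

Lemma nbhd_retract_attach_gauge :
  nbhd_retract R (A `|` Phi @` [set v | q v <= 1]).
Proof.
exists W, emb, dom, ret; split => //.
by move=> z; rewrite inE; exact: ret_cont.
Qed.

End Attach.

(** * Finite subcomplexes *)

Section CellComplex.
Variables (R : realType) (Y : topologicalType) (y0 : Y) (I : Type) (dim : I -> nat).
Variable Phi : forall i, 'rV[R]_(dim i) -> Y.
Let cell i := Phi (i:=i) @` odisk (n:=dim i).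
Let cells (s : seq I) : set Y := [set y | exists j, List.In j s /\ cell j y].
Hypothesis hausY : hausdorff_space Y.
Hypothesis Phi_cont : forall i, {within cdisk (n:=dim i), continuous (@Phi i)}.
Hypothesis Phi_inj : forall i u v, odisk (n:=dim i) u -> odisk (n:=dim i) v ->
  @Phi i u = @Phi i v -> u = v.
Hypothesis cell_disjoint : forall i j, i <> j -> cell i `&` cell j = set0.
Hypothesis cell_cover : forall y, exists i, cell i y.
Hypothesis cell_boundary : forall i, exists s : seq I,
  (forall j, List.In j s -> (dim j < dim i)%N) /\
  @Phi i @` sphere (n:=dim i) `<=` cells s.
Hypothesis weak_topology : forall A : set Y,
  closed A <-> forall i, closed (A `&` closure (cell i)).

Let cell_uniq i j y : cell i y -> cell j y -> i = j.
Proof.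
move=> iy jy; apply: contrapT => /cell_disjoint ij.
have : (cell i `&` cell j) y by [].
by rewrite ij.
Qed.

Let cellsS s t : (forall j, List.In j s -> List.In j t) -> cells s `<=` cells t.
Proof. by move=> st y [j [js jy]]; exists j; split => //; exact: st. Qed.

Let cdisk_split i : @Phi i @` cdisk (n:=dim i) =
  cell i `|` @Phi i @` sphere (n:=dim i).
Proof.
apply/seteqP; split => y.
  move=> [v + <-]; rewrite /cdisk/= le_eqVlt => /orP[/eqP v1|v1].
    by right; exists v.
  by left; exists v.
by move=> [|] [v v1 <-]; exists v => //; rewrite /cdisk/=; [exact: ltW|rewrite v1].
Qed.

Let closure_cell i s : @Phi i @` sphere (n:=dim i) `<=` cells s ->
  closure (cell i) `<=` cells (i :: s).
Proof.
move=> is_; apply: (@subset_trans _ (@Phi i @` cdisk (n:=dim i))).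
  have : closed (@Phi i @` cdisk (n:=dim i)).
    apply: compact_closed => //; apply: continuous_compact => //; exact: cdisk_compact.
  by apply: subset_trans; apply: closureS; rewrite cdisk_split; left.
rewrite cdisk_split => y [iy|/is_]; first by exists i; split => //; left.
by apply: cellsS => j; right.
Qed.

(** Choose a point [pt i] in each cell meeting [C]. The closure of a cell meets only finitely many
    cells, so every set of chosen points is closed by the weak topology. Removing the chosen points
    outside the cell of [y] leaves an open neighbourhood of [y], and compactness of [C] leaves
    finitely many cells. *)
Lemma compact_finite_cells (C : set Y) : compact C -> exists s, C `<=` cells s.
Proof.
move=> cC; have [idx idxP] := choice cell_cover.
pose pt i := xget y0 (C `&` cell i).
pose T := [set y | exists i, y = pt i /\ (C `&` cell i) y].
have finpt l : finite_set [set y | exists j, List.In j l /\ y = pt j].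
  elim: l => [|i l IH].
    by rewrite (_ : mkset _ = set0)//; apply/seteqP; split => // y [j []].
  apply: sub_finite_set (_ : finite_set (pt i |` _)); last first.
    by rewrite finite_setU; split; [exact: finite_set1|exact: IH].
  by move=> y [j [[->|jl] ->]]; [left|right; exists j].
have closedT T' : T' `<=` T -> closed T'.
  move=> T'T; apply/weak_topology => i; have [s [_ /closure_cell si]] := cell_boundary i.
  move/hausdorff_accessible/accessible_finite_set_closed : (hausY); apply.
  apply: sub_finite_set (finpt (i :: s)) => y [/T'T[j [-> [_ jy]]] /si[k [ks ky]]].
  by exists j; split => //; rewrite (cell_uniq jy ky).
(* Finite lists ordered by inclusion: compactness along this filter yields one list that works for
   all points of [C]. *)
pose F : set_system (seq I) :=
  filter_from setT (fun s => [set t | forall i, List.In i s -> List.In i t]).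
have FF : Filter F.
  apply: filter_from_filter; first by exists nil.
  move=> s t _ _; exists (s ++ t) => // u stu; split => i ?; apply: stu.
    by apply: List.in_or_app; left.
  by apply: List.in_or_app; right.
pose P s y := forall i, y = pt i -> (C `&` cell i) y -> List.In i s.
have /compact_near_coveringP/(_ _ F P FF)[y Cy|s _ sP] := cC.
  exists (~` (T `\` cell (idx y)), [set t | List.In (idx y) t]).
    split; last by exists [:: idx y] => // t; apply; left.
    apply: open_nbhs_nbhs; split; last by case=> _; apply; exact: idxP.
    by apply: closed_openC; apply: closedT => z [].
  move=> [z t] /= [nz yt] i zi Cz; have [//|nzy] := pselect (cell (idx y) z).
    by move=> /cell_uniq /(_ Cz.2) <-.
  by case: nz; split => //; exists i.
exists s => y Cy; exists (idx y); split; last exact: idxP.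
have Cpt : (C `&` cell (idx y)) (pt (idx y)).
  by apply: (@xgetPex _ y0 (C `&` cell (idx y))); exists y; split => //; exact: idxP.
by apply: (sP s _ (pt (idx y))) => //; case: Cpt.
Qed.

(** The head of the list is the cell attached last, so induction on the list attaches one cell at a
    time. The absence of repetitions keeps a new open cell disjoint from the earlier cells. *)
Fixpoint subcomplex (L : seq I) : Prop :=
  if L is i :: L' then
    [/\ subcomplex L', ~ List.In i L' & @Phi i @` sphere (n:=dim i) `<=` cells L']
  else True.

(** Induction on the dimension bound: the boundaries of the cells in [s] lie in finitely many cells
    [t] of smaller dimension, which the induction hypothesis places in a subcomplex [L0]; then the
    missing cells of [s] are attached one by one. *)
Lemma subcomplex_extend d s : (forall j, List.In j s -> (dim j < d)%N) ->
  exists L, subcomplex L /\ forall j, List.In j s -> List.In j L.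
Proof.
elim: d s => [|d IH] s sd.
  by exists nil; split => // j /sd.
have [t [td st]] : exists t, (forall k, List.In k t -> (dim k < d)%N) /\
    forall i, List.In i s -> @Phi i @` sphere (n:=dim i) `<=` cells t.
  elim: s sd => [|i s IHs] sd; first by exists nil; split => // i [].
  have [j js|t [td st]] := IHs; first by apply: sd; right.
  have [u [ui iu]] := cell_boundary i.
  exists (u ++ t); split.
    move=> k kut; have [/ui ku|/td//] := List.in_app_or _ _ _ kut.
    by rewrite (leq_trans ku)// -ltnS; apply: sd; left.
  move=> k [<-|/st kt].
    by apply: (subset_trans iu); apply: cellsS => j ju; apply: List.in_or_app; left.
  by apply: (subset_trans kt); apply: cellsS => j ju; apply: List.in_or_app; right.
have [L0 [gL0 tL0]] := IH t td.
suff [L [gL _ sL]] : exists L, [/\ subcomplex L, forall j, List.In j L0 -> List.In j L &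
    forall j, List.In j s -> List.In j L] by exists L.
have {}st i : List.In i s -> @Phi i @` sphere (n:=dim i) `<=` cells L0.
  by move=> /st it; apply: (subset_trans it); exact: cellsS.
elim: s st {sd} => [|i s IHs] st; first by exists L0; split => // j [].
have [j js|L [gL L0L sL]] := IHs; first by apply: st; right.
have [iL|niL] := pselect (List.In i L).
  by exists L; split => // j [<-//|/sL].
exists (i :: L); split => /=; last first.
- by move=> j [->|/sL]; [left|right].
- by move=> j /L0L; right.
split => //; apply: (@subset_trans _ (cells L0)); last exact: cellsS.
by apply: st; left.
Qed.

Lemma nbhd_retract_attach (A : set Y) i : closed A -> nbhd_retract R A ->
  (forall v, odisk v -> ~ A (@Phi i v)) -> @Phi i @` sphere (n:=dim i) `<=` A ->
  nbhd_retract R (A `|` @Phi i @` cdisk (n:=dim i)).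
Proof.
move=> cA [V [iA [UA [rA [iAc UAo rAc rAi rAK]]]]] nA sA.
have dE : @cdisk R (dim i) = [set v : 'rV[R]_(dim i) | gauge v <= 1].
  by apply/seteqP; split => v /cdiskE.
have cP := @Phi_cont i; have cD := @cdisk_compact R (dim i).
rewrite dE in cP cD *.
apply: (@nbhd_retract_attach_gauge R 'rV[R]_(dim i) (@gauge R (dim i))
  _ _ _ Y A (@Phi i) _ _ _ _ _ _ V iA UA rA) => //.
- exact: gaugeZ.
- exact: gauge_continuous.
- by move=> u v /odiskE u1 /odiskE v1; exact: Phi_inj.
- by move=> v /odiskE; exact: nA.
- by move=> v /sphereE v1; apply: sA; exists v.
Qed.

Lemma subcomplex_nbhd_retract L :
  subcomplex L -> [/\ closed (cells L), compact (cells L) & nbhd_retract R (cells L)].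
Proof.
elim: L => [_|i L IH /= [/IH[cL kL nL] iL sL]].
  have -> : cells [::] = set0 by apply/seteqP; split => // y [j []].
  split; [exact: closed0|exact: compact0|].
  exists R, (fun=> 0), set0, (fun=> y0); split => //; first exact: continuous_subspace0.
  by move=> z; rewrite inE.
have -> : cells (i :: L) = cells L `|` @Phi i @` cdisk (n:=dim i).
  apply/seteqP; split => y.
    by move=> [j [[<-|jL] jy]]; [right; rewrite cdisk_split; left|left; exists j].
  rewrite cdisk_split => -[|[|/sL]]; last by apply: cellsS => j; right.
    by apply: cellsS => j; right.
  by move=> iy; exists i; split => //; left.
have kP : compact (@Phi i @` cdisk (n:=dim i)).
  by apply: continuous_compact => //; exact: cdisk_compact.
split.
- by apply: closedU => //; exact: compact_closed.
- exact: compactU.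
- apply: nbhd_retract_attach => // v v1 [j [jL jv]]; apply: iL.
  by rewrite (@cell_uniq i j (Phi v))//; exists v.
Qed.

Lemma compact_sub_nbhd_retract (C : set Y) : compact C ->
  exists K : set Y, [/\ C `<=` K, compact K & nbhd_retract R K].
Proof.
move=> /compact_finite_cells[s Cs].
have [d sd] : exists d, forall j, List.In j s -> (dim j < d)%N.
  elim: s {Cs} => [|i s [d IH]]; first by exists 0%N.
  exists (maxn d (dim i).+1) => j [<-|/IH jd]; rewrite leq_max ?leqnn ?orbT//.
  by rewrite jd.
have [L [gL sL]] := subcomplex_extend sd.
have [_ kL nL] := subcomplex_nbhd_retract gL.
by exists (cells L); split => //; apply: (subset_trans Cs); exact: cellsS.
Qed.

End CellComplex.

Lemma cellular_compact_sub_nbhd_retract (R : realType) (Y : topologicalType)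
    (y0 : Y) (C : set Y) : cellular_space R y0 -> compact C ->
  exists K : set Y, [/\ C `<=` K, compact K & nbhd_retract R K].
Proof.
move=> [hY [I [dim [Phi [Pc [Pi [_ [Pd [Pcov [Pb [Pw _]]]]]]]]]]].
exact: (compact_sub_nbhd_retract y0 hY Pc Pi Pd Pcov Pb Pw).
Qed.

(** * Mapping spaces and paths *)

Section CompactOpen.
Variables (T X Y : topologicalType) (A : set T) (F : T -> X -> Y).

(** This is the tube lemma, applied along the compact set [K] that tests convergence in the
    compact-open topology. *)
Lemma curry_within :
  {within A `*` [set: X], continuous (fun p : T * X => F p.1 p.2)} ->
  {within A, continuous (F : T -> {compact-open, X -> Y})}.
Proof.
move=> /subspace_continuousP cF; apply/subspace_continuousP => t At.
apply/compact_open_cvgP => K O cK oO FKO.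
have : \forall t' \near within A (nbhs t), K `<=` (fun x => O (F t' x)).
  move: cK => /compact_near_coveringP; apply => x Kx.
  have [[P Q] /= [nP nQ] PQ] : nbhs (t, x) [set p | (A `*` setT) p -> O (F p.1 p.2)].
    apply: (cF (t, x)) => //; apply: open_nbhs_nbhs; split => //.
    by apply: FKO; exists x.
  exists (Q, A `&` P).
    by split => //; apply: filterS nP => t' Pt' At'; split.
  by move=> [x' t'] /= [Qx' [At' Pt']]; apply: (PQ (t', x')).
by apply: filterS => t' h _ [x Kx <-]; exact: h.
Qed.

(** A point of [X] has a closed, hence compact, neighbourhood that [F t] maps into the given open
    set; the compact-open topology keeps its image there for nearby parameters. *)
Lemma uncurry_within : hausdorff_space X -> compact [set: X] ->
  (forall t, A t -> continuous (F t)) ->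
  {within A, continuous (F : T -> {compact-open, X -> Y})} ->
  {within A `*` [set: X], continuous (fun p : T * X => F p.1 p.2)}.
Proof.
move=> hX cX cFt /subspace_continuousP cF; apply/subspace_continuousP => -[t x] [/= At _] O.
rewrite nbhsE => -[P [oP PF] PO].
have nx : nbhs x (F t @^-1` P) by apply: cFt => //; exact: open_nbhs_nbhs.
have [C nC CO] := compact_regular hX cX (filterT : nbhs x setT) nx.
have cC : compact (closure C) by apply: subclosed_compact cX _ => //; exact: closed_closure.
have /compact_open_cvgP/(_ _ _ cC oP) := cF t At.
have FC : F t @` closure C `<=` P by move=> _ [z Cz <-]; exact: CO.
move=> /(_ FC) nA.
exists ([set t' | A t' -> F t' @` closure C `<=` P], C); first by split.
move=> [t' x'] /= [h Cx' [At' _]]; apply: PO; apply: (h At'); exists x' => //.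
exact: subset_closure.
Qed.

End CompactOpen.

Section Paths.
Variable R : realType.
Local Notation I := (@unit_interval R).

Lemma unit_intervalE : I = `[0, 1]%classic.
Proof. by apply/seteqP; split => t; rewrite /= in_itv. Qed.

Lemma unit_interval_compact : compact I.
Proof. by rewrite unit_intervalE; exact: segment_compact. Qed.

(** The last clause hands over to the concatenation any property shared by the points of both paths,
    such as being a based map. *)
Lemma path_concat (T : topologicalType) (g1 g2 : R -> T) :
  {within I, continuous g1} -> {within I, continuous g2} -> g1 1 = g2 0 ->
  exists g : R -> T, [/\ {within I, continuous g}, g 0 = g1 0, g 1 = g2 1 &
    forall t, I t -> exists2 s, I s & g t = g1 s \/ g t = g2 s].
Proof.
move=> c1 c2 g12.
pose g t := if t <= 1 / 2 then g1 (2 * t) else g2 (2 * t - 1).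
pose A := [set t : R | 0 <= t] `&` [set t | t <= 1 / 2].
pose B := [set t : R | 1 / 2 <= t] `&` [set t | t <= 1].
have gA t : t <= 1 / 2 -> g t = g1 (2 * t) by rewrite /g => ->.
have gB t : 1 / 2 <= t -> g t = g2 (2 * t - 1).
  move=> h; rewrite /g; case: ifPn => // h2.
  have -> : t = 1 / 2 by apply/eqP; rewrite eq_le h2 h.
  by rewrite mul1r divff// subrr.
exists g; split.
- have -> : I = A `|` B.
    apply/seteqP; split => t /=.
      move=> /andP[t0 t1]; have [h|h] := leP t (1 / 2); [by left|right].
      by split => //=; exact: ltW.
    by move=> [[/= h1 h2]|[/= h1 h2]]; apply/andP; split; lra.
  apply: withinU_continuous.
  + by apply: closedI; [exact: closed_ge|exact: closed_le].
  + by apply: closedI; [exact: closed_ge|exact: closed_le].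
  + apply: (@subspace_eq_continuous _ _ _ (fun t : R => g1 (2 * t))).
      by move=> t; rewrite inE => -[/= _ h]; exact: esym (gA _ h).
    apply/subspace_continuousP => t [/= t0 t1].
    apply: (@cvg_comp_within _ _ _ _ (fun t : R => 2 * t) (2 * t) I g1).
    * by apply: cvgM; [exact: cvg_cst|exact: cvg_within].
    * by apply: within_subset_near => s [/= s0 s1]; apply/andP; split; lra.
    * apply: (proj1 (subspace_continuousP _ _) c1).
      by apply/andP; split; lra.
  + apply: (@subspace_eq_continuous _ _ _ (fun t : R => g2 (2 * t - 1))).
      by move=> t; rewrite inE => -[/= h _]; exact: esym (gB _ h).
    apply/subspace_continuousP => t [/= t0 t1].
    apply: (@cvg_comp_within _ _ _ _ (fun t : R => 2 * t - 1) (2 * t - 1) I g2).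
    * apply: cvgB; last exact: cvg_cst.
      by apply: cvgM; [exact: cvg_cst|exact: cvg_within].
    * by apply: within_subset_near => s [/= s0 s1]; apply/andP; split; lra.
    * apply: (proj1 (subspace_continuousP _ _) c2).
      by apply/andP; split; lra.
- by rewrite gA ?mulr0//; lra.
- by rewrite gB; [congr g2; lra|lra].
- move=> t /andP[t0 t1]; have [h|h] := leP t (1 / 2).
    by exists (2 * t); [apply/andP; split; lra|left; exact: gA].
  by exists (2 * t - 1); [apply/andP; split; lra|right; apply: gB; exact: ltW].
Qed.

Variables (X Y : topologicalType) (x0 : X) (y0 : Y).

Lemma path_comp_trans (a b c : X -> Y) : path_comp R x0 y0 a b ->
  path_comp R x0 y0 b c -> path_comp R x0 y0 a c.
Proof.
move=> [g1 [<- [<- [b1 c1]]]] [g2 [g12 [<- [b2 c2]]]].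
have [g [cg g0 g1E gE]] :=
  @path_concat {compact-open, X -> Y} g1 g2 c1 c2 (esym g12).
exists g; do 3 split => //.
by move=> t /gE[s Is [->|->]]; [exact: b1|exact: b2].
Qed.

Lemma within_slice (T U V : topologicalType) (A : set T) (B : set U) (f : T * U -> V) t :
  A t -> {within A `*` B, continuous f} -> {within B, continuous (fun u => f (t, u))}.
Proof.
move=> At /subspace_continuousP cf; apply/subspace_continuousP => u Bu.
apply: (@cvg_comp_within _ _ _ _ (fun u => (t, u)) (t, u) (A `*` B) f).
- by apply: cvg_pair_pt; [exact: cvg_cst|exact: cvg_within].
- by apply: within_subset_near => u' Bu'.
- exact: cf.
Qed.

Lemma within_swap (T U V : topologicalType) (A : set T) (B : set U) (f : T * U -> V) :
  {within A `*` B, continuous f} -> {within B `*` A, continuous (fun p => f (p.2, p.1))}.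
Proof.
move=> /subspace_continuousP cf; apply/subspace_continuousP => -[u t] [/= Bu At].
apply: (@cvg_comp_within _ _ _ _ (fun p => (p.2, p.1)) (t, u) (A `*` B) f).
- apply: cvg_pair_pt; first by apply: cvg_within_restrict; exact: cvg_snd.
  by apply: cvg_within_restrict; exact: cvg_fst.
- by apply: within_subset_near => -[u' t'] [].
- exact: cf.
Qed.

Lemma path_comp_joint (H : R -> X -> Y) :
  {within I `*` [set: X], continuous (fun p : R * X => H p.1 p.2)} ->
  (forall t, I t -> H t x0 = y0) -> path_comp R x0 y0 (H 0) (H 1).
Proof.
move=> cH H0; exists H; split => //; split => //; split; last exact: curry_within.
move=> t It; split; last exact: H0.
exact: (proj2 (continuous_subspace_setT _) (within_slice It cH)).
Qed.

Lemma based_homotopic_path_comp (f g : X -> Y) :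
  based_homotopic R x0 y0 f g -> path_comp R x0 y0 f g.
Proof.
move=> [H [cH [H0 [H1 Hb]]]].
have -> : f = H^~ 0 by apply/funext => x; rewrite H0.
have -> : g = H^~ 1 by apply/funext => x; rewrite H1.
by apply: (@path_comp_joint (fun t x => H x t)) => //; exact: (within_swap cH).
Qed.

End Paths.

(** * Formal sums of maps *)

Definition push (W W' : Type) (f : W -> W') (s : seq (int * W)) : seq (int * W') :=
  [seq (p.1, f p.2) | p <- s].

Definition equiv (W : Type) (e : W -> W -> Prop) : Prop :=
  [/\ forall w, e w w, forall w w', e w w' -> e w' w &
      forall u v w, e u v -> e v w -> e u w].

Section FormalSums.
Variables (W : Type) (agree : W -> W -> Prop).
Hypothesis agree_equiv : equiv agree.

Let asbool_agree u v w : agree u v -> `[< agree u w >] = `[< agree v w >].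
Proof.
have [_ sym trans] := agree_equiv => uv.
by apply/asboolP/asboolP => h; apply: trans h => //; exact: sym.
Qed.

(* Induction on the size: the terms in the class of the head generator cancel,
   and removing them leaves a shorter null sum. *)
Lemma fzero_eval (phi : W -> int) (s : seq (int * W)) :
  (forall w w', agree w w' -> phi w = phi w') -> fzero agree s ->
  \sum_(p <- s) p.1 * phi p.2 = 0.
Proof.
have [refl sym trans] := agree_equiv => phiE.
elim: (size s) {-2}s (leqnn (size s)) => {s} [|n IH] [|p s]//; rewrite ?big_nil// => sn s0.
pose c (q : int * W) := `[< agree q.2 p.2 >].
rewrite (bigID c)/= [X in X + _](_ : _ = fcoef agree (p :: s) p.2 * phi p.2); last first.
  rewrite /fcoef mulr_suml [LHS]big_mkcond/=; apply: eq_bigr => q _.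
  rewrite /c; case: asboolP => [qp|_]; last by rewrite mul0r.
  by rewrite (phiE _ _ qp).
rewrite s0 mul0r add0r -big_filter; apply: IH.
  have -> : [seq q <- p :: s | ~~ c q] = [seq q <- s | ~~ c q].
    by rewrite /= /c; case: asboolP => // h; case: h.
  by rewrite size_filter (leq_trans (count_size _ _)).
move=> w; rewrite /fcoef big_filter.
have [wp|nwp] := pselect (agree w p.2).
  rewrite big1// => q; rewrite /c => /asboolP nq; case: asboolP => // qw.
  by case: nq; exact: trans qw wp.
rewrite -[RHS](s0 w) /fcoef [RHS](bigID c)/= [X in _ = X + _]big1 ?add0r//.
move=> q /asboolP qp; case: asboolP => // qw; case: nwp.
by apply: trans qp; exact: sym.
Qed.

(** A coefficient of the image sum is the original sum evaluated on the indicator of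
    [agree' (f u) w], which is constant on classes. *)
Lemma fzero_push (W' : Type) (agree' : W' -> W' -> Prop) (f : W -> W') s :
  equiv agree' -> (forall u v, agree u v -> agree' (f u) (f v)) ->
  fzero agree s -> fzero agree' (push f s).
Proof.
move=> [_ sym trans] fagree s0 w; rewrite /fcoef /push big_map.
rewrite (eq_bigr (fun p => p.1 * (if `[< agree' (f p.2) w >] then 1 else 0))); last first.
  by move=> p _ /=; case: ifPn => _; rewrite ?mulr1 ?mulr0.
apply: (@fzero_eval (fun u => if `[< agree' (f u) w >] then 1 else 0)) => // u v uv.
congr (if _ then _ else _); apply/asboolP/asboolP => h.
  by apply: trans h; apply: sym; exact: fagree.
by apply: trans h; exact: fagree.
Qed.

Lemma feq_fzero s s' :
  feq agree s s' <-> fzero agree (s ++ [seq (- p.1, p.2) | p <- s']).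
Proof.
have E w : fcoef agree (s ++ [seq (- p.1, p.2) | p <- s']) w =
    fcoef agree s w - fcoef agree s' w.
  rewrite /fcoef big_cat big_map -sumrN/=; congr (_ + _).
  by apply: eq_bigr => p _ /=; case: ifPn => _; rewrite ?oppr0.
split=> h w; first by rewrite E h subrr.
by have := h w; rewrite E => /eqP; rewrite subr_eq0 => /eqP.
Qed.

Lemma feq_Forall2 s s' :
  List.Forall2 (fun p q => p.1 = q.1 /\ agree p.2 q.2) s s' -> feq agree s s'.
Proof.
move=> h w; rewrite /fcoef; elim: h => [|p q {}s {}s' [pq1 pq2] _ IH].
  by rewrite !big_nil.
by rewrite !big_cons IH pq1 (asbool_agree _ pq2).
Qed.

End FormalSums.

Lemma push_opp (W W' : Type) (f : W -> W') (s : seq (int * W)) :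
  [seq (- p.1, p.2) | p <- push f s] = push f [seq (- p.1, p.2) | p <- s].
Proof. by rewrite /push -!map_comp. Qed.

Lemma feq_push (W W' : Type) (agree : W -> W -> Prop) (agree' : W' -> W' -> Prop)
    (f : W -> W') s s' : equiv agree -> equiv agree' ->
  (forall u v, agree u v -> agree' (f u) (f v)) ->
  feq agree s s' -> feq agree' (push f s) (push f s').
Proof.
move=> e e' fagree /feq_fzero h; apply/feq_fzero.
rewrite push_opp (_ : _ ++ _ = push f (s ++ [seq (- p.1, p.2) | p <- s'])).
  exact: fzero_push h.
by rewrite /push map_cat.
Qed.

(** * Fissility and the filtration under maps acting on values *)

Section Fissile.
Variables (R : realType) (X Y : topologicalType) (y0 : Y) (E : finType).
Local Notation W := ((E -> R) -> X -> Y).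

Lemma agree_on_equiv (D : set (E -> R)) : equiv (@agree_on R X Y E D).
Proof.
split=> [//|w w' ww' t Dt|u v w uv vw t Dt]; first by rewrite ww'.
by rewrite uv// vw.
Qed.

Variable phi : X -> Y -> Y.

Definition pointwise (w : W) : W := fun t x => phi x (w t x).

(** Acting on values commutes with gluing along faces. Off the faces one side has the default value
    [y0] and the other [phi x y0], hence agreement is claimed only on the union of the faces. *)
Lemma combine_pointwise (Fs : seq {set E}) (S : seq (int * W)) :
  List.Forall2 (fun p q => p.1 = q.1 /\
      agree_on [set t | exists F, F \in Fs /\ simplex F t] p.2 q.2)
    (combine y0 Fs (push pointwise S)) (push pointwise (combine y0 Fs S)).
Proof.
elim: Fs => [|F Fs IH] /=.
  by constructor => //; split => // t [F []].
move: (combine y0 Fs (push pointwise S)) (combine y0 Fs S) IH => c1 c2 IH.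
elim: S => [|p s IHs] /=; first by constructor.
rewrite [push pointwise (_ ++ _)]map_cat; apply: List.Forall2_app IHs.
rewrite /push -!map_comp in IH *.
elim: c2 c1 IH => [|q' c2 IHc] c1 h; inversion h as [|q ? l ? [qq1 qq2] hl]; subst => /=.
  by constructor.
have {IHc}IHl := IHc _ hl.
constructor => //=; split; first by rewrite qq1.
move=> t [G [+ Gt]]; rewrite inE => GF.
case: asboolP => Ft; rewrite /pointwise.
  by case: asboolP.
rewrite qq2; last first.
  by exists G; split => //; case/orP: GF => // /eqP GF; case: Ft; rewrite -GF.
by case: asboolP.
Qed.

Lemma fissile_pointwise (S : seq (int * W)) :
  fissile y0 S -> fissile y0 (push pointwise S).
Proof.
move=> fS A lA.
have eA := agree_on_equiv (layout_space (R := R) A).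
have h1 : feq (agree_on (layout_space A)) (push pointwise S)
    (push pointwise (combine y0 (enum A) S)).
  by apply: feq_push (fS A lA) => // u v uv t At; apply/funext => x; rewrite /pointwise uv.
have AE : layout_space A = [set t : E -> R | exists F, F \in enum A /\ simplex F t].
  by apply/seteqP; split => t [F [FA Ft]]; exists F; rewrite mem_enum in FA *.
have h2 : feq (agree_on (layout_space A)) (combine y0 (enum A) (push pointwise S))
    (push pointwise (combine y0 (enum A) S)).
  by apply: feq_Forall2 => //; rewrite AE; exact: combine_pointwise.
by move=> w; rewrite h1 h2.
Qed.

(** The action carries the whole difference of [b] and [S] to that of [b'] and the transported sum,
    and new values at finitely many points depend only on old values there. *)
Lemma in_filt_pointwise (r : nat) (b b' : X -> Y) (S : seq (int * W)) :
  (forall x, phi x (b x) = b' x) ->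
  in_filt r ((1%:Z, fun=> b) :: [seq (- p.1, p.2) | p <- S]) ->
  in_filt r ((1%:Z, fun=> b') :: [seq (- p.1, p.2) | p <- push pointwise S]).
Proof.
move=> bb' fS ps psr psE; rewrite push_opp.
have -> : ((1%:Z, fun=> b') :: push pointwise [seq (- p.1, p.2) | p <- S] =
    push pointwise ((1%:Z, fun=> b) :: [seq (- p.1, p.2) | p <- S])).
  by rewrite /push /=; congr ((_, _) :: _); apply/funext => t; apply/funext => x;
    rewrite /pointwise bb'.
have ee : equiv (fun w w' : W => forall p, List.In p ps -> w p.1 p.2 = w' p.1 p.2).
  split=> [//|w w' h p pp|u v w h1 h2 p pp]; first by rewrite h.
  by rewrite h1// h2.
apply: fzero_push (fS ps psr psE) => // u v uv p pp.
by rewrite /pointwise uv.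
Qed.

End Fissile.

(** * Transport along a homotopy *)

Lemma simplex_compact (R : realType) (E : finType) :
  compact (simplex (R := R) [set: E]%SET : set {ptws E -> R}).
Proof.
have cB : compact [set f : {ptws E -> R} | forall e, `[0, 1]%classic (f e)].
  by apply: (@tychonoff E (fun=> R) (fun=> `[0, 1]%classic)) => e; exact: segment_compact.
apply: (subclosed_compact _ cB).
  have -> : simplex (R := R) [set: E]%SET =
      (\bigcap_(e in [set: E]) (fun f : {ptws E -> R} => f e) @^-1` [set x | 0 <= x]) `&`
      (fun f : {ptws E -> R} => \sum_(e : E) f e) @^-1` [set x | x = 1].
    apply/seteqP; split => f.
      by move=> [f0 [f1 _]]; split => // e _; exact: f0.
    move=> [f0 f1]; split; first by move=> e; exact: f0.
    by split => // e; rewrite finset.in_setT.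
  have ce (e : E) : continuous (fun f : {ptws E -> R} => f e).
    exact: (@proj_continuous E (fun=> R) e).
  apply: closedI.
    by apply: closed_bigI => e _; apply: closed_comp => [f _|]; [exact: ce|exact: closed_ge].
  apply: closed_comp; last exact: closed_eq.
  move=> f _; move: f; apply: continuous_big => [|e _]; first exact: add_continuous.
  exact: ce.
move=> f [f0 [f1 _]] e /=; rewrite in_itv/= f0/= -f1 (bigD1 e)//= lerDl.
by apply: sumr_ge0 => *; exact: f0.
Qed.

Section Transport.
Variables (R : realType) (X Y : topologicalType) (x0 : X) (y0 : Y).
Hypotheses (hausX : hausdorff_space X) (compactX : compact [set: X]).
Variables (K : set Y) (V : normedModType R) (i : Y -> V) (U : set V) (r : V -> Y).
Hypothesis compactK : compact K.
Hypothesis i_cont : {within K, continuous i}.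
Hypothesis U_open : open U.
Hypothesis r_cont : {in U, continuous r}.
Hypothesis r_in : forall u, U u -> K (r u).
Hypothesis rK : forall y, K y -> U (i y) /\ r (i y) = y.

Local Notation I := (@unit_interval R).

(** A Lebesgue number for the compact set [K]: displacements shorter than [e] stay in the domain of
    [r]. *)
Lemma retract_margin : exists2 e : R, 0 < e &
  forall y v, K y -> `|v| < e -> U (i y + v).
Proof.
pose P (e : R) y := forall v, `|v| < e -> U (i y + v).
suff : \forall e \near 0^'+, K `<=` P e.
  move=> /(filterI (nbhs_right_gt 0)) /filter_ex[e [e0 eP]].
  by exists e => // y v Ky; exact: eP.
have /near_covering_withinP := proj1 (compact_near_coveringP _) compactK.
apply=> y Ky; have [Uy _] := rK Ky.
have /nbhs_ballP[e /= e0 eU] : nbhs (i y) U by exact: open_nbhs_nbhs.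
have e2 : 0 < e / 2 by rewrite divr_gt0.
exists ([set y' | K y' -> ball (i y) (e / 2) (i y')], [set d | d < e / 2]).
  split => /=; last exact: nbhs_right_lt.
  by apply: (proj1 (subspace_continuousP _ _) i_cont y Ky); exact: nbhsx_ballx.
move=> [y' d] /= [yy' d2] Ky' v vd; apply: eU; rewrite (splitr e).
apply: ball_triangle (yy' Ky') _; rewrite -ball_normE/= opprD addrA subrr sub0r normrN.
exact: lt_trans vd d2.
Qed.

(** Uniform continuity in time, by compactness of the product of [X] and the interval; distances are
    measured in [V] through [i]. *)
Lemma time_modulus (h : X -> R -> Y) (e : R) : 0 < e ->
  {within [set: X] `*` I, continuous (fun p : X * R => h p.1 p.2)} ->
  (forall x t, I t -> K (h x t)) ->
  exists2 d : R, 0 < d & forall x t t', I t -> I t' -> `|t - t'| < d ->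
    `|i (h x t') - i (h x t)| < e.
Proof.
move=> e0 ch hK.
pose P (d : R) (p : X * R) := forall t', I t' -> `|p.2 - t'| < d ->
  `|i (h p.1 t') - i (h p.1 p.2)| < e.
suff : \forall d \near 0^'+, [set: X] `*` I `<=` P d.
  move=> /(filterI (nbhs_right_gt 0)) /filter_ex[d [d0 dP]].
  by exists d => // x t t' It It'; exact: (dP (x, t)).
have /compact_near_coveringP/near_covering_withinP :=
  compact_setX compactX (@unit_interval_compact R).
apply=> -[x t] [_ /= It].
have e2 : 0 < e / 2 by rewrite divr_gt0.
have cih : (i \o (fun p : X * R => h p.1 p.2)) @
    within ([set: X] `*` I) (nbhs (x, t)) --> i (h x t).
  apply: (@cvg_comp_within _ _ _ _ (fun p : X * R => h p.1 p.2) (h x t) K i).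
  - exact: (proj1 (subspace_continuousP _ _) ch (x, t)).
  - by apply: within_subset_near => p [_ Ip]; exact: hK Ip.
  - by apply: (proj1 (subspace_continuousP _ _) i_cont); exact: hK.
have [[Q1 Q2] /= [nQ1 nQ2] Q12] : nbhs (x, t) [set p | ([set: X] `*` I) p ->
    ball (i (h x t)) (e / 2) (i (h p.1 p.2))].
  exact: (cih _ (nbhsx_ballx _ _ e2)).
have /nbhs_ballP[d /= d0 dQ] := nQ2.
have d2 : 0 < d / 2 by rewrite divr_gt0.
exists (Q1 `*` ball t (d / 2), [set d' | d' < d / 2]).
  split => /=; last exact: nbhs_right_lt.
  by exists (Q1, ball t (d / 2)) => //; split => //; exact: nbhsx_ballx.
move=> [[x' t'] d'] /= [[Q1x' tt'] d'd] [_ It'] t'' It'' t't''.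
have td : ball t d t'.
  by apply: le_ball tt'; rewrite ler_pdivrMr// ler_peMr ?ltW//; lra.
have td' : ball t d t''.
  rewrite (splitr d); apply: ball_triangle tt' _; rewrite -ball_normE/=.
  exact: lt_trans t't'' d'd.
have b1 : ball (i (h x t)) (e / 2) (i (h x' t')).
  by apply: (Q12 (x', t')); split => //; exact: dQ.
have b2 : ball (i (h x t)) (e / 2) (i (h x' t'')).
  by apply: (Q12 (x', t'')); split => //; exact: dQ.
have := ball_triangle (ball_sym b2) b1; rewrite -splitr -ball_normE/=.
by rewrite distrC.
Qed.

Section Step.
Variables b b' : X -> Y.
Hypotheses (b_cont : continuous b) (b'_cont : continuous b').
Hypotheses (bK : forall x, K (b x)) (b'K : forall x, K (b' x)).
Hypothesis near_bb' : forall s x y, I s -> K y -> U (i y + s *: (i (b' x) - i (b x))).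

Let phi (s : R) (x : X) (y : Y) : Y := r (i y + s *: (i (b' x) - i (b x))).

Let phi0 x y : K y -> phi 0 x y = y.
Proof. by move=> Ky; rewrite /phi scale0r addr0; have [] := rK Ky. Qed.

Let phi1 x : phi 1 x (b x) = b' x.
Proof. by rewrite /phi scale1r addrC subrK; have [] := rK (b'K x). Qed.

Let phiK s x y : I s -> K y -> K (phi s x y).
Proof. by move=> Is Ky; apply: r_in; exact: near_bb'. Qed.

(** The parameter space is arbitrary because two cases occur: the simplex with [s] constantly one,
    for the transported simplex, and the interval with [s] the identity, for the path to the
    transported map. *)
Let phi_joint (T : topologicalType) (A : set T) (w : T -> X -> Y) (s : T -> R) :
  {within A `*` [set: X], continuous (fun p : T * X => w p.1 p.2)} ->
  {within A, continuous s} -> (forall t x, A t -> K (w t x)) ->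
  (forall t, A t -> I (s t)) ->
  {within A `*` [set: X], continuous (fun p : T * X => phi (s p.1) p.2 (w p.1 p.2))}.
Proof.
move=> cw cs wK sI; apply/subspace_continuousP => -[t x] [/= At _].
have ci (c : X -> Y) : continuous c -> (forall x, K (c x)) ->
    i (c p.2) @[p --> within (A `*` [set: X]) (nbhs (t, x))] --> i (c x).
  move=> cc cK; apply: (@cvg_comp_within _ _ _ _ (fun p : T * X => c p.2) (c x) K i).
  - apply: cvg_within_restrict.
    apply: (@cvg_comp _ _ _ (fun p : T * X => p.2) c _ (nbhs x)); last exact: cc.
    exact: cvg_snd.
  - by apply: within_subset_near => p _; exact: cK.
  - exact: (proj1 (subspace_continuousP _ _) i_cont).
apply: (@cvg_comp _ _ _ (fun p : T * X => i (w p.1 p.2) + s p.1 *: (i (b' p.2) - i (b p.2))) r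
   _ (nbhs (i (w t x) + s t *: (i (b' x) - i (b x))))); last first.
  by apply: r_cont; rewrite inE; apply: near_bb'; [exact: sI|exact: wK].
apply: cvgD.
  apply: (@cvg_comp_within _ _ _ _ (fun p : T * X => w p.1 p.2) (w t x) K i).
  - exact: (proj1 (subspace_continuousP _ _) cw (t, x)).
  - by apply: within_subset_near => -[t' x'] [/= At' _]; exact: wK.
  - by apply: (proj1 (subspace_continuousP _ _) i_cont); exact: wK.
apply: cvgZ; last by apply: cvgB; exact: ci.
apply: (@cvg_comp_within _ _ _ _ (fun p : T * X => p.1) t A s).
- by apply: cvg_within_restrict; exact: cvg_fst.
- by apply: within_subset_near => -[t' x'] [].
- exact: (proj1 (subspace_continuousP _ _) cs).
Qed.

Hypotheses (b0 : b x0 = y0) (b'0 : b' x0 = y0).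
Variables (E : finType) (a : X -> Y) (n : nat).

(** A witness of strong similarity whose values lie in [K]; this extra clause allows the transport
    to be repeated. *)
Definition similar_in (S : seq (int * ((E -> R) -> X -> Y))) (c : X -> Y) : Prop :=
  [/\ forall p, List.In p S -> simp_map x0 y0 (path_comp R x0 y0 a) p.2 /\
        (forall t x, simplex [set: E]%SET t -> K (p.2 t x)),
      fissile y0 S &
      in_filt n ((1%:Z, fun=> c) :: [seq (- p.1, p.2) | p <- S])].

Lemma similar_step S : similar_in S b ->
  similar_in (push (pointwise (phi 1)) S) b'.
Proof.
have I1 : I 1 by rewrite /unit_interval/= ler01 lexx.
have Ky0 : K y0 by rewrite -b0.
(* At [x0] the displacement is [i y0 - i y0 = 0], so every stage is based. *)
have phi_base s : phi s x0 y0 = y0.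
  by rewrite /phi b0 b'0 subrr scaler0 addr0; have [] := rK Ky0.
move=> [SP fS iS]; split; last first.
- exact: in_filt_pointwise iS.
- exact: fissile_pointwise.
move=> p; rewrite /push => /List.in_map_iff[q [<- /SP[[qP cq] qK]]] /=.
have jq : {within (simplex [set: E]%SET : set {ptws E -> R}) `*` [set: X],
    continuous (fun z : {ptws E -> R} * X => q.2 z.1 z.2)}.
  by apply: uncurry_within => // t /qP[[]].
split; last by move=> t x Dt; apply: phiK => //; exact: qK.
split; last first.
  apply: (@curry_within {ptws E -> R} X Y (simplex [set: E]%SET)
     (fun t x => phi 1 x (q.2 t x))).
  apply: (@phi_joint {ptws E -> R} (simplex [set: E]%SET) q.2 (fun=> 1)).
  - exact: jq.
  - by apply/subspace_continuousP => t _; exact: cvg_cst.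
  - by move=> t x Dt; exact: qK.
  - by move=> t Dt; exact: I1.
move=> t Dt; have [[cqt qt0] aq] := qP t Dt.
have jp : {within I `*` [set: X], continuous (fun z : R * X => phi z.1 z.2 (q.2 t z.2))}.
  apply: (@phi_joint R I (fun=> q.2 t) id).
  - apply: continuous_subspaceT => z.
    apply: (@cvg_comp _ _ _ (fun z : R * X => z.2) (q.2 t) _ (nbhs z.2)).
      exact: cvg_snd.
    exact: cqt.
  - by apply/subspace_continuousP => s _; exact: cvg_within.
  - by move=> s x _; exact: qK.
  - by move=> s.
(* Letting [s] run from [0] to [1] joins the old map to the transported one, so the component of [a]
   is not left. *)
have pathq : path_comp R x0 y0 (q.2 t) (pointwise (phi 1) q.2 t).
  have {1}-> : q.2 t = fun x => phi 0 x (q.2 t x).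
    by apply/funext => x; rewrite phi0//; exact: qK.
  apply: (@path_comp_joint R X Y x0 y0 (fun s x => phi s x (q.2 t x))) => //.
  by move=> s _; rewrite qt0 phi_base.
split; last exact: path_comp_trans aq pathq.
by have [g [_ [<- [gb _]]]] := pathq; exact: gb.
Qed.

End Step.

Lemma similar_homotopy (E : finType) (a : X -> Y) (n : nat) (h : X -> R -> Y)
    (S : seq (int * ((E -> R) -> X -> Y))) :
  {within [set: X] `*` I, continuous (fun p : X * R => h p.1 p.2)} ->
  (forall x t, I t -> K (h x t)) -> (forall t, I t -> h x0 t = y0) ->
  similar_in a n S (h^~ 0) ->
  exists S' : seq (int * ((E -> R) -> X -> Y)), similar_in a n S' (h^~ 1).
Proof.
move=> ch hK h0 S0; have [e e0 eU] := retract_margin.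
have [d d0 dP] := time_modulus e0 ch hK.
(* Consecutive times will be [N^-1] apart. The archimedean bound gives [N^-1 < d], and the successor
   makes [N] positive. *)
pose N := (Num.bound d^-1).+1.
have N0 : (0 : R) < N%:R by rewrite ltr0n.
have Nd : N%:R^-1 < d.
  rewrite -[d]invrK ltf_pV2 ?posrE ?invr_gt0//.
  rewrite (lt_trans (archi_boundP _)) ?invr_ge0 ?(ltW d0)//.
  by rewrite ltr_nat.
have IN k : (k <= N)%N -> I (k%:R / N%:R).
  by move=> kN; rewrite /unit_interval/= divr_ge0// ler_pdivrMr// mul1r ler_nat.
have hc t : I t -> continuous (h^~ t).
  move=> It; apply/continuous_subspace_setT.
  exact: (within_slice It (within_swap ch)).
have reach k : (k <= N)%N -> exists S' : seq (int * ((E -> R) -> X -> Y)),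
    similar_in a n S' (h^~ (k%:R / N%:R)); last first.
  by have [S' S'P] := reach N (leqnn N); exists S'; rewrite divff ?gt_eqF in S'P.
elim: k => [_|k IH kN]; first by exists S; rewrite mul0r.
have [S' S'P] := IH (ltnW kN).
have Ik := IN _ (ltnW kN); have Ik1 := IN _ kN.
exists (push (pointwise (fun x y =>
  r (i y + 1 *: (i (h x (k.+1%:R / N%:R)) - i (h x (k%:R / N%:R)))))) S').
apply: (@similar_step (h^~ (k%:R / N%:R)) (h^~ (k.+1%:R / N%:R))) S'P.
- exact: hc.
- exact: hc.
- by move=> x; exact: hK.
- by move=> x; exact: hK.
- move=> s x y /andP[s0 s1] Ky; apply: eU => //; rewrite normrZ ger0_norm//.
  apply: le_lt_trans (dP x _ _ Ik Ik1 _); first by rewrite ler_piMl.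
  rewrite (_ : `|_| = N%:R^-1)// -mulrBl -[k.+1]addn1 natrD opprD addrA subrr.
  by rewrite sub0r mulN1r normrN ger0_norm// invr_ge0 ltW.
- exact: h0.
- exact: h0.
Qed.

End Transport.

(** Each simplex of maps uncurries to a continuous map on the compact product of the simplex with
    [X]; finitely many such images have compact union. *)
Lemma simp_maps_range (R : realType) (X Y : topologicalType) (x0 : X) (y0 : Y)
    (E : finType) (P : set (X -> Y)) (S : seq (int * ((E -> R) -> X -> Y))) :
  hausdorff_space X -> compact [set: X] ->
  (forall p, List.In p S -> simp_map x0 y0 P p.2) ->
  exists2 C : set Y, compact C &
    forall p t x, List.In p S -> simplex [set: E]%SET t -> C (p.2 t x).
Proof.
move=> hX cX; elim: S => [_|p S IH pS].
  by exists set0 => //; exact: compact0.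
have [q qS|C cC CS] := IH; first by apply: pS; right.
have [pP cp] : simp_map x0 y0 P p.2 by apply: pS; left.
pose D : set {ptws E -> R} := simplex (R := R) [set: E]%SET.
exists ([set p.2 z.1 z.2 | z in D `*` [set: X]] `|` C).
  apply: compactU => //; apply: continuous_compact.
    by apply: (@uncurry_within {ptws E -> R}) => // t /pP[[]].
  by apply: compact_setX => //; exact: simplex_compact.
move=> q t x [<-|qS] Dt; first by left; exists (t, x).
by right; exact: CS.
Qed.

Theorem theorem6p1 (R : realType) (X Y : topologicalType) (x0 : X) (y0 : Y)
  (r : nat) (a b a' b' : X -> Y) :
  cellular_space R x0 -> cellular_space R y0 -> compact [set: X] ->
  based_map x0 y0 a -> based_map x0 y0 b ->
  based_map x0 y0 a' -> based_map x0 y0 b' ->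
  based_homotopic R x0 y0 a' a ->
  strongly_similar R x0 y0 r a b ->
  based_homotopic R x0 y0 b b' ->
  strongly_similar R x0 y0 r a' b'.
Proof.
move=> [hX _] cY kX _ _ _ _ ha ss [h [ch [h0 [h1 hb]]]] E E0.
have [S [SP [fS iS]]] := ss E E0.
have [C cC CS] := simp_maps_range hX kX SP.
have cH : compact [set h z.1 z.2 | z in [set: X] `*` @unit_interval R].
  apply: continuous_compact => //; apply: compact_setX => //.
  exact: unit_interval_compact.
have [K [CK cK [V [i [U [r' [ic Uo rc rin rK]]]]]]] :=
  cellular_compact_sub_nbhd_retract cY (compactU cC cH).
have hK x t : unit_interval t -> K (h x t).
  by move=> It; apply: CK; right; exists (x, t).
(* The homotopy from [a'] to [a] enters here: the ensemble chosen for [a] takes its values in the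
   component of [a']. *)
have aa' f : path_comp R x0 y0 a f -> path_comp R x0 y0 a' f.
  by apply: path_comp_trans; exact: based_homotopic_path_comp.
have [|S' [S'P fS' iS']] := @similar_homotopy R X Y x0 y0 hX kX K V i U r'
    cK ic Uo rc rin rK E a' r.+1 h S ch hK hb.
  split => //; last by rewrite (_ : h^~ 0 = b)//; apply/funext.
  move=> p pS; split; last by move=> t x Dt; apply: CK; left; exact: CS.
  have [pP cp] := SP p pS; split => // t Dt.
  by have [bp /aa' ap] := pP t Dt.
exists S'; split; first by move=> p /S'P[].
by split => //; rewrite (_ : b' = h^~ 1)//; apply/funext => x; rewrite h1.
Qed.
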